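(* Let $n$ be a positive integer, let $f : M_n(\mathbb{R}) \to \mathbb{R}$ be $f(A) = \det(A)$, and let $S = SL(n,\mathbb{R}) = f^{-1}(1)$, regarded as a hypersurface in $M_n(\mathbb{R}) \cong \mathbb{R}^{n^2}$ oriented by the unit normal vector field $N = \nabla f / \|\nabla f\|$. Then: 1. The Gauss map of $S$ is given by $N(A) = (A^{-1})^{T} / \|A^{-1}\|$ for all $A \in S$. 2. The spherical image of $S$ is $\{A \in S^{n^2-1} : \det(A) > 0\}$. Consequently, the spherical image is symmetric about $0$ (i.e. invariant under $A \mapsto -A$) if and only if $n$ is even. 3. The Weingarten map of $S$ at the identity matrix $I$ is given by $L_I(H) = n^{-1/2} H^{T}$ for all $H \in S_I$. 4. The principal curvatures of $S$ at $I$ are $n^{-1/2}$ and $-n^{-1/2}$, with respective multiplicities $\frac{n^2+n-2}{2}$ and $\frac{n^2-n}{2}$.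
   Context: $M_n(\mathbb{R})$ is the space of real $n \times n$ matrices, identified with $\mathbb{R}^{n^2}$ with its standard Euclidean inner product, so that $\|C\| = \sqrt{\sum_{i,j} c_{ij}^2}$ for $C = (c_{ij})$, and $\nabla f$ is the Euclidean gradient, i.e. the matrix with $(i,j)$ entry $\partial f / \partial a_{ij}$ (it vanishes nowhere on $S$). $S^{n^2-1}$ denotes the unit sphere $\{A \in M_n(\mathbb{R}) : \|A\| = 1\}$, and $T$ denotes transpose. Tangent vectors are identified with their vector parts: for $p \in S$, the tangent space $S_p$ is the linear subspace of $M_n(\mathbb{R})$ of all tangent vectors to $S$ at $p$. In particular $S_I = sl_n$, the space of matrices of trace $0$. The Gauss map of $S$ is the map $N : S \to S^{n^2-1}$, $N(A) = \nabla f(A)/\|\nabla f(A)\|$. The spherical image of $S$ is the range of the Gauss map. The Weingarten map of $S$ at $p \in S$ is the linear map $L_p : S_p \to S_p$ defined by $L_p(v) = -(N \circ \alpha)'(0)$, where $\alpha$ is any smooth curve in $S$ defined on an open interval of $\mathbb{R}$ containing $0$, with $\alpha(0) = p$ and $\alpha'(0) = v$ (the value is independent of the choice of $\alpha$); equivalently $L_p(v) = -\widetilde{N}'(p)(v)$ for any smooth extension $\widetilde{N}$ of $N$ to an open neighbourhood of $p$ in $M_n(\mathbb{R})$. The principal curvatures of $S$ at $p$ are the eigenvalues of $L_p$, with multiplicities being the dimensions of the corresponding eigenspaces (a value with multiplicity $0$ is not an eigenvalue). *)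

(* Defs.v *)
From HB Require Import structures.
From mathcomp Require Import all_boot all_order all_algebra.
From mathcomp Require Import all_classical all_reals all_analysis.
Set Implicit Arguments.
Unset Strict Implicit.
Unset Printing Implicit Defensive.
Import Order.TTheory GRing.Theory Num.Theory.
Import numFieldNormedType.Exports.
Local Open Scope classical_set_scope.
Local Open Scope ring_scope.

Section Hypersurface.
Context {R : realType} {n : nat}.
Implicit Types (f : 'M[R]_n -> R) (S : set 'M[R]_n) (N : 'M[R]_n -> 'M[R]_n).
Implicit Types (p v : 'M[R]_n) (J : set R) (alpha : R -> 'M[R]_n).

(* The Euclidean norm; the norm [`|A|] of the library is the sup norm, which
   induces the same topology and hence the same derivatives. *)
Definition enorm (A : 'M[R]_n) : R := Num.sqrt (\sum_i \sum_j A i j ^+ 2).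

Definition unit_sphere : set 'M[R]_n := [set A | enorm A = 1].

Definition gradient f (A : 'M[R]_n) : 'M[R]_n :=
  \matrix_(i, j) 'D_(delta_mx i j) f A.

Definition gauss_map f (A : 'M[R]_n) : 'M[R]_n :=
  (enorm (gradient f A))^-1 *: gradient f A.

Definition spherical_image f S : set 'M[R]_n := gauss_map f @` S.

Definition smooth_on J alpha : Prop :=
  forall (k : nat) (t : R), J t -> derivable (derive1n k alpha) t 1.

(* [alpha] is a total function, but only its restriction to the open interval
   [J] is relevant. *)
Definition smooth_curve S p v J alpha : Prop :=
  [/\ open J, is_interval J & J 0] /\
  [/\ smooth_on J alpha, (forall t, J t -> S (alpha t)),
      alpha 0 = p & derive1 alpha 0 = v].

Definition tangent_space S p : set 'M[R]_n :=
  [set v | exists J alpha, smooth_curve S p v J alpha].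

(* [L], acting on the linear subspace [U], is the Weingarten map at [p] of [S]
   oriented by [N].  This determines [U], and then [L], uniquely, since every
   tangent vector is the velocity of some curve. *)
Definition is_weingarten_map S N p
    (U : {vspace 'M[R]_n}) (L : 'End(subvs_of U)) : Prop :=
  [set v | v \in U] = tangent_space S p /\
  forall (v : subvs_of U) J alpha, smooth_curve S p (vsval v) J alpha ->
    is_derive (0 : R) 1 (N \o alpha) (- vsval (L v)).

End Hypersurface.

Definition SL (R : realType) (n : nat) : set 'M[R]_n := [set A | \det A = 1].
Arguments SL : clear implicits.

(* Main.v *)
Require Import Defs.
From HB Require Import structures.
From mathcomp Require Import all_boot all_order all_algebra.
From mathcomp Require Import all_classical all_reals all_analysis.
From mathcomp Require Import ring zify.
Set Implicit Arguments.
Unset Strict Implicit.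
Unset Printing Implicit Defensive.
Import Order.TTheory GRing.Theory Num.Theory.
Import numFieldNormedType.Exports.
Local Open Scope classical_set_scope.
Local Open Scope ring_scope.

(** By the cofactor expansion, det is affine along each coordinate direction
[delta_mx i j], with slope the cofactor; so its gradient at A is the transpose
of [\adj A], which on SL(n) is the transpose of [invmx A] (lemma
[gauss_map_det]). A matrix of norm 1 and positive determinant d is the normal
at [c *: invmx A^T] with c the n-th root of d, which gives the spherical image
(lemma [spherical_image_SL]); since det (- A) = (-1) ^ n det A, its symmetry is
the parity of n.

At the identity the curves in SL(n) have exactly the traceless velocities (lemma
[tangent_space_SL]): the derivative of det at 1 is the trace, and conversely a
traceless v is the velocity of 1 + t v with its first row divided by
det (1 + t v), a curve with rational entries. Along a curve alpha in SL(n) the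
Gauss map is the transpose of [\adj (alpha t)], which is the inverse of
alpha t, divided by its norm. Differentiating alpha * \adj alpha = 1
at 0 shows that the adjugate has velocity - v; the norm is stationary because v
is traceless, so the Gauss map has velocity - c v^T with c = 1 / sqrt n (lemma
[is_derive_gauss_map]). Hence L v = c v^T.

The principal curvatures are thus c and - c, on the traceless symmetric and on
the antisymmetric matrices. Their dimensions s - 1 and a come from the two
relations s + a = n ^ 2 and s = n + a (lemmas [dim_symmetric_antisymmetric] and
[dim_symmetric]), where s is the dimension of all symmetric matrices. *)

(** * Calculus of matrix-valued functions and of the determinant *)

Section MatrixCalculus.
Context {R : realType}.

Lemma is_derive_mxP {V : normedModType R} {m n : nat}
    (M : V -> 'M[R]_(m, n)) (t v : V) (D : 'M[R]_(m, n)) :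
  is_derive t v M D <->
  forall i j, is_derive t v (fun x => M x i j) (D i j).
Proof.
split=> [[dM <-] i j|dM].
  rewrite derive_mx// mxE; apply: derivableP.
  exact: (derivable_mxP _ _ _).1.
have dM' : derivable M t v by apply/derivable_mxP => i j; case: (dM i j).
apply: DeriveDef => //; rewrite derive_mx//.
by apply/matrixP => i j; rewrite mxE; case: (dM i j).
Qed.

Lemma is_derive_bigsum {V W : normedModType R} (n : nat) (h : 'I_n -> V -> W)
    (x v : V) (dh : 'I_n -> W) :
  (forall i, is_derive x v (h i) (dh i)) ->
  is_derive x v (fun y => \sum_i h i y) (\sum_i dh i).
Proof.
move=> dhi; rewrite [X in is_derive _ _ X _](_ : _ = \sum_i h i).
  exact: is_derive_sum.
by apply/funext => y; rewrite fct_sumE.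
Qed.

Lemma is_derive_mulmx {V : normedModType R} {m n p : nat}
    (A : V -> 'M[R]_(m, n)) (B : V -> 'M[R]_(n, p)) (t v : V) dA dB :
  is_derive t v A dA -> is_derive t v B dB ->
  is_derive t v (fun x => A x *m B x) (dA *m B t + A t *m dB).
Proof.
move=> /is_derive_mxP hA /is_derive_mxP hB; apply/is_derive_mxP => i j.
rewrite !mxE -big_split/=.
rewrite [X in is_derive _ _ X _](_ : _ = fun x => \sum_k A x i k * B x k j).
  apply: is_derive_bigsum => k; have hAk := hA i k; have hBk := hB k j.
  apply: is_derive_eq (is_deriveM hAk hBk) _.
  by rewrite /GRing.scale/= addrC mulrC; congr (_ + _); exact: mulrC.
by apply/funext => x; rewrite mxE.
Qed.

Lemma differentiable_bigprod {V : normedModType R} (I : Type) (r : seq I)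
    (h : I -> V -> R) (x : V) :
  (forall i, differentiable (h i) x) ->
  differentiable (fun y => \prod_(i <- r) h i y) x.
Proof.
move=> dh; elim: r => [|i r IHr].
  by under eq_fun do rewrite big_nil; exact: differentiable_cst.
by under eq_fun do rewrite big_cons; exact: differentiableM.
Qed.

Lemma differentiable_bigsum {V W : normedModType R} (I : Type) (r : seq I)
    (h : I -> V -> W) (x : V) :
  (forall i, differentiable (h i) x) ->
  differentiable (fun y => \sum_(i <- r) h i y) x.
Proof.
move=> dh; elim: r => [|i r IHr].
  by under eq_fun do rewrite big_nil; exact: differentiable_cst.
by under eq_fun do rewrite big_cons; exact: differentiableD.
Qed.

Lemma differentiable_det n (A : 'M[R]_n) :
  differentiable (fun B : 'M[R]_n => \det B : R) A.
Proof.
apply: differentiable_bigsum => s.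
apply: differentiableM; first exact: differentiable_cst.
by apply: differentiable_bigprod => i; exact: differentiable_coord.
Qed.

(** The cofactors along row i do not involve row i, so expanding along that row
is affine in the entry (i, j). *)
Lemma det_add_delta n (A : 'M[R]_n) i j (h : R) :
  \det (h *: delta_mx i j + A) = \det A + h * cofactor A i j.
Proof.
rewrite (expand_det_row _ i) (expand_det_row A i).
rewrite (bigD1 j)//= [in RHS](bigD1 j)//= !mxE !eqxx/= mulr1.
have cofE k : cofactor (h *: delta_mx i j + A) i k = cofactor A i k.
  rewrite /cofactor; congr (_ * \det _); apply/matrixP => a b.
  by rewrite !mxE eq_sym (negPf (neq_lift _ _)) mulr0 add0r.
rewrite cofE mulrDl [RHS]addrC addrA; congr (_ + _).
apply: eq_bigr => k kj; rewrite cofE !mxE (negPf kj) andbF.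
by rewrite mulr0 add0r.
Qed.

(** By [det_add_delta] the difference quotient is constant, equal to the
cofactor, away from 0. *)
Lemma derive_det_delta n (A : 'M[R]_n) i j :
  'D_(delta_mx i j) (fun B : 'M[R]_n => \det B) A = cofactor A i j.
Proof.
apply: cvg_lim => //; apply: cvg_near_cst.
near=> h; rewrite /= det_add_delta addrC addKr /GRing.scale/= mulKf//.
by near: h; exact: nbhs_dnbhs_neq.
Unshelve. all: by end_near. Qed.

(** Jacobi's formula, from the partial derivatives: det is differentiable,
being a polynomial in the entries, hence its differential is linear. *)
Lemma diff_det n (A H : 'M[R]_n) :
  'd (fun B : 'M[R]_n => \det B : R) A H =
  \sum_i \sum_j H i j * cofactor A i j.
Proof.
rewrite [in LHS](matrix_sum_delta H) linear_sum; apply: eq_bigr => i _.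
rewrite linear_sum; apply: eq_bigr => j _.
rewrite linearZ -deriveE ?derive_det_delta//.
exact: differentiable_det.
Qed.

Lemma is_derive_det n (A : R -> 'M[R]_n) (t : R) (dA : 'M[R]_n) :
  is_derive t 1 A dA ->
  is_derive t 1 (fun x => \det (A x))
    (\sum_i \sum_j dA i j * cofactor (A t) i j).
Proof.
move=> [/derivable1_diffP diffA <-].
have diffd := differentiable_det (A t).
apply: DeriveDef.
  exact/derivable1_diffP/(differentiable_comp diffA diffd).
rewrite (deriveE _ diffA) -diff_det deriveE; last first.
  exact: (differentiable_comp diffA diffd).
by rewrite (diff_comp diffA diffd).
Qed.

Lemma derivable_adj n (A : R -> 'M[R]_n) (t : R) :
  derivable A t 1 -> derivable (fun x => \adj (A x)) t 1.
Proof.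
move=> /derivable_mxP dA; apply/derivable_mxP => i j.
under eq_fun do rewrite mxE.
apply: derivableM; first exact: derivable_cst.
have /derivableP dM :
    derivable (fun x => row' j (col' i (A x))) t 1.
  by apply/derivable_mxP => a b; under eq_fun do rewrite !mxE; exact: dA.
by case: (is_derive_det dM).
Qed.

End MatrixCalculus.

Section SpecialLinearCurves.
Context {R : realType} {n : nat}.
Implicit Types (A B : R -> 'M[R]_n) (v : 'M[R]_n).

Lemma cofactor1 i j : cofactor (1%:M : 'M[R]_n) i j = (i == j)%:R.
Proof.
have := mul_mx_adj (1%:M : 'M[R]_n).
by rewrite mul1mx det1 => /matrixP /(_ j i); rewrite !mxE eq_sym.
Qed.

Lemma sum_cofactor1 v :
  \sum_i \sum_j v i j * cofactor (1%:M : 'M[R]_n) i j = \tr v.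
Proof.
apply: eq_bigr => i _; rewrite (bigD1 i)//= cofactor1 eqxx mulr1.
rewrite big1 ?addr0// => j ji; rewrite cofactor1 eq_sym (negPf ji).
by rewrite mulr0.
Qed.

(** The derivative of the constant det (A t) is, by Jacobi's formula at the
identity, the trace of the velocity. *)
Lemma SL_velocity_trace A v :
  A 0 = 1%:M -> is_derive (0 : R) 1 A v -> (\forall t \near (0 : R), \det (A t) = 1) ->
  \tr v = 0.
Proof.
move=> A0 dA detA.
have d1 := is_derive_det dA.
have d2 : is_derive (0 : R) 1 (fun x => \det (A x)) 0.
  apply: near_eq_is_derive (is_derive_cst (1 : R) (0 : R) 1).
  by near=> t; apply/esym; near: t.
have := @derive_val _ _ _ _ _ _ _ d1.
by rewrite (@derive_val _ _ _ _ _ _ _ d2) A0 sum_cofactor1.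
Unshelve. all: by end_near. Qed.

(** Differentiate A t *m \adj (A t) = 1 at 0, where both factors are 1; the
adjugate is differentiable because its entries are determinants. *)
Lemma is_derive_adj1 A v :
  A 0 = 1%:M -> is_derive (0 : R) 1 A v -> (\forall t \near (0 : R), \det (A t) = 1) ->
  is_derive (0 : R) 1 (fun t => \adj (A t)) (- v).
Proof.
move=> A0 dA detA.
have [dA' _] := dA.
have /derivableP dB := derivable_adj dA'.
have d1 := is_derive_mulmx dA dB.
have d2 : is_derive (0 : R) 1 (fun x => A x *m \adj (A x)) 0.
  apply: near_eq_is_derive (is_derive_cst (1%:M : 'M[R]_n) (0 : R) 1).
  by near=> t; rewrite /cst mul_mx_adj; congr (_%:M); apply/esym; near: t.
have := @derive_val _ _ _ _ _ _ _ d1.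
rewrite (@derive_val _ _ _ _ _ _ _ d2) A0 adj1 mulmx1 mul1mx.
by move=> /esym/eqP; rewrite addr_eq0 eq_sym eqr_oppLR => /eqP <-.
Unshelve. all: by end_near. Qed.

Lemma sum_sqr_scalar1 :
  \sum_i \sum_j (1%:M : 'M[R]_n) i j ^+ 2 = n%:R.
Proof.
rewrite -[in RHS](card_ord n) -sum1_card natr_sum; apply: eq_bigr => i _.
rewrite (bigD1 i)//= !mxE eqxx expr1n big1 ?addr0// => j ji.
by rewrite mxE eq_sym (negPf ji) expr0n.
Qed.

Lemma is_derive_enorm1 B v : (0 < n)%N ->
  B 0 = 1%:M -> is_derive (0 : R) 1 B v ->
  is_derive (0 : R) 1 (fun t => enorm (B t)) (\tr v / Num.sqrt n%:R).
Proof.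
move=> n_gt0 B0 /is_derive_mxP dB.
have dq : is_derive (0 : R) 1 (fun t => \sum_i \sum_j B t i j ^+ 2)
    (2 * \tr v).
  have dij i j : is_derive (0 : R) 1 (fun t => B t i j ^+ 2)
      (2 * (i == j)%:R * v i j).
    have h := dB i j; apply: is_derive_eq (is_deriveM h h) _.
    by rewrite B0 mxE /GRing.scale/= mulr2n mulrDl mulrDl !mul1r.
  apply: is_derive_eq.
    by apply: is_derive_bigsum => i; apply: is_derive_bigsum => j; exact: dij.
  rewrite mulr_sumr; apply: eq_bigr => i _; rewrite (bigD1 i)//= eqxx mulr1.
  by rewrite big1 ?addr0// => j ji; rewrite eq_sym (negPf ji) mulr0 mul0r.
have q0 : \sum_i \sum_j B 0 i j ^+ 2 = n%:R.
  by rewrite B0 sum_sqr_scalar1.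
have ds : is_derive (\sum_i \sum_j B 0 i j ^+ 2) 1 Num.sqrt
    (2 * Num.sqrt n%:R)^-1.
  by rewrite q0; apply: is_derive1_sqrt; rewrite ltr0n.
apply: is_derive_eq (is_derive1_comp ds dq) _.
by rewrite invfM mulrACA mulVf ?mul1r 1?mulrC// pnatr_eq0.
Qed.

End SpecialLinearCurves.

(** * The tangent space of SL(n) at the identity *)

Section TangentSpace.
Context {R : realType}.

(** The denominator is kept as a power of one polynomial q, so that the shape
of the fraction is preserved by differentiation and the lemma can be iterated. *)
Lemma is_derive_horner_frac (p q : {poly R}) (m : nat) (t : R) :
  q.[t] != 0 ->
  is_derive t 1 (fun x => p.[x] / q.[x] ^+ m)
    ((p^`() * q - q^`() * p *+ m).[t] / q.[t] ^+ m.+1).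
Proof.
move=> qt0.
have qm0 : (q ^+ m).[t] != 0 by rewrite horner_exp expf_neq0.
have dV := is_deriveV qm0 (is_derive_poly (q ^+ m) t).
have dp := is_derive_poly p t.
rewrite [X in is_derive _ _ X _](_ : _ = fun x => p.[x] * (q ^+ m).[x]^-1).
  apply: is_derive_eq (is_deriveM dp dV) _.
  rewrite /GRing.scale/= deriv_exp !(hornerE, horner_exp, hornerMn).
  case: m {qm0 dV} => [|m] /=.
    by rewrite !expr0 !mulr0n subr0 expr1 invr1 mul1r !mulr0 add0r mulfK.
  rewrite -[X in _ * X]mulr_natl -[X in _ = (_ - X) / _]mulr_natl !exprS.
  move: (m.+1%:R) => r.
  have : q.[t] ^+ m != 0 by rewrite expf_neq0.
  by move: qt0; move: q.[t] (q.[t] ^+ m) => a z a0 z0; field; rewrite a0 z0.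
by apply/funext => x; rewrite horner_exp.
Qed.

(** [derive1n] differentiates the total function A, about which nothing is known
outside J; openness of J makes the derivative at a point of J depend only on
the values in J. *)
Lemma derive1n_rational n (J : set R) (A : R -> 'M[R]_n)
    (P : 'I_n -> 'I_n -> {poly R}) (q : {poly R}) (k : nat) :
  open J -> (forall t, J t -> q.[t] != 0) ->
  (forall t, J t -> A t = \matrix_(i, j) ((P i j).[t] / q.[t])) ->
  exists Q : 'I_n -> 'I_n -> {poly R}, forall t, J t ->
    derive1n k A t = \matrix_(i, j) ((Q i j).[t] / q.[t] ^+ k.+1).
Proof.
move=> oJ q0 AE; elim: k => [|k [Q IHk]]; first by exists P.
exists (fun i j => (Q i j)^`() * q - q^`() * (Q i j) *+ k.+1) => t Jt.
rewrite derive1nS derive1E.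
pose G x : 'M[R]_n := \matrix_(i, j) ((Q i j).[x] / q.[x] ^+ k.+1).
rewrite (near_eq_derive (g := G)); last first.
  by near=> x; apply: IHk; near: x; exact: open_nbhs_nbhs.
apply: derive_val; apply/is_derive_mxP => i j; rewrite mxE.
under eq_fun do rewrite mxE.
exact: is_derive_horner_frac (q0 _ Jt).
Unshelve. all: by end_near. Qed.

Lemma smooth_on_rational n (J : set R) (A : R -> 'M[R]_n)
    (P : 'I_n -> 'I_n -> {poly R}) (q : {poly R}) :
  open J -> (forall t, J t -> q.[t] != 0) ->
  (forall t, J t -> A t = \matrix_(i, j) ((P i j).[t] / q.[t])) ->
  smooth_on J A.
Proof.
move=> oJ q0 AE k t Jt; have [Q QE] := derive1n_rational k oJ q0 AE.
pose G x : 'M[R]_n := \matrix_(i, j) ((Q i j).[x] / q.[x] ^+ k.+1).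
apply: (near_eq_derivable (f := G)).
  by near=> x; apply/esym/QE; near: x; exact: open_nbhs_nbhs.
apply/derivable_mxP => i j; under eq_fun do rewrite mxE.
by case: (is_derive_horner_frac (Q i j) k.+1 (q0 _ Jt)).
Unshelve. all: by end_near. Qed.

Lemma smooth_curve_SL_near n (v : 'M[R]_n) J A :
  smooth_curve (SL R n) 1%:M v J A ->
  [/\ A 0 = 1%:M, is_derive (0 : R) 1 A v &
      \forall t \near (0 : R), \det (A t) = 1].
Proof.
move=> [[oJ _ J0] [sA SA A0 A'0]]; split=> //.
  by apply: DeriveDef; [exact: (sA 0%N)|rewrite -derive1E].
by near=> t; apply: SA; near: t; exact: open_nbhs_nbhs.
Unshelve. all: by end_near. Qed.

(** The curve 1 + t v leaves SL(n); dividing its first row by its determinant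
q t brings it back. This does not change the velocity, since q 0 = 1 and
q' 0 = \tr v = 0, and it keeps the entries rational, hence smooth. *)
Lemma SL_curve_exists n (v : 'M[R]_n) : \tr v = 0 ->
  exists J A, smooth_curve (SL R n) 1%:M v J A.
Proof.
case: n v => [|n] v trv.
  (* For n = 0 there is no first row, and the constant curve serves. *)
  exists setT, (cst 1%:M); split.
    by split=> //; exact: openT.
  split=> //; first by move=> k t _; apply/derivable_mxP; case.
  - by move=> t _; exact: det1.
  - by apply/matrixP; case.
pose M : 'M[{poly R}]_n.+1 := \matrix_(i, j) ((i == j)%:R%:P + v i j *: 'X).
pose q := \det M.
pose d t : 'rV[R]_n.+1 := \row_i (if i == ord0 then q.[t]^-1 else 1).
pose B t : 'M[R]_n.+1 := 1%:M + t *: v.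
pose A t : 'M[R]_n.+1 := diag_mx (d t) *m B t.
have ME t i j : (M i j).[t] = B t i j by rewrite !mxE !hornerE mulrC.
have qE t : q.[t] = \det (B t).
  rewrite -[LHS]/(horner_eval t _) -det_map_mx; congr (\det _).
  by apply/matrixP => i j; rewrite mxE -ME.
have B0 : B 0 = 1%:M by rewrite /B scale0r addr0.
have q0 : q.[0] = 1 by rewrite qE B0 det1.
have AE t i j : A t i j = (if i == ord0 then q.[t]^-1 else 1) * B t i j.
  by rewrite /A mul_diag_mx !mxE.
have dB : is_derive (0 : R) 1 B v.
  apply/is_derive_mxP => i j.
  rewrite [X in is_derive _ _ X _](_ : _ = horner (M i j)).
    apply: is_derive_eq (is_derive_poly _ _) _.
    by rewrite !mxE derivD derivC derivZ derivX !hornerE.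
  by apply/funext => t; rewrite ME.
(* Jacobi's formula at the identity: q' 0 is the trace of v. *)
have q'0 : q^`().[0] = 0.
  have d1 := is_derive_det dB.
  have d2 := is_derive_poly q 0.
  rewrite -(@derive_val _ _ _ _ _ _ _ d2).
  have -> : horner q = fun t => \det (B t) by apply/funext => t; rewrite qE.
  by rewrite (@derive_val _ _ _ _ _ _ _ d1) B0 sum_cofactor1.
have : \forall t \near (0 : R), q.[t] != 0.
  have := @continuous_horner _ q 0.
  move=> /cvgr_neq0; apply; rewrite q0; exact: oner_neq0.
move=> /nbhs_ballP[e /= e0 Jq].
pose J := ball (0 : R) e.
have oJ : open J by exact: ball_open.
have J0 : J 0 by exact: ballxx.
exists J, A; split; first split=> //.
  by rewrite /J ball_itv; exact: interval_is_interval.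
split.
- apply: (@smooth_on_rational _ _ _
    (fun i j => if i == ord0 then M i j else M i j * q) q) => // t Jt.
  apply/matrixP => i j; rewrite AE -ME [RHS]mxE; case: ifP => _.
    exact: mulrC.
  by rewrite hornerM mulfK ?mul1r//; exact: Jq.
- move=> t Jt; rewrite /SL/= /A det_mulmx det_diag big_ord_recl/= mxE eqxx.
  rewrite big1 ?mulr1; last by move=> i _; rewrite mxE.
  by rewrite -qE mulVf//; exact: Jq.
- apply/matrixP => i j; rewrite AE q0 B0 invr1.
  by case: ifP => _; rewrite mul1r.
- rewrite derive1E; apply: derive_val; apply/is_derive_mxP => i j.
  have [i0|i0] := eqVneq i ord0; last first.
    rewrite [X in is_derive _ _ X _](_ : _ = fun t => B t i j).
      by have /is_derive_mxP := dB; exact.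
    by apply/funext => t; rewrite AE (negPf i0) mul1r.
  rewrite [X in is_derive _ _ X _](_ : _ = fun t => (M i j).[t] / q.[t] ^+ 1).
    apply: is_derive_eq; first by apply: is_derive_horner_frac; rewrite q0 oner_neq0.
    rewrite mulr1n !hornerE q'0 q0 expr1n divr1 mul0r subr0 mulr1.
    by rewrite mxE derivD derivC derivZ derivX !hornerE.
  by apply/funext => t; rewrite AE i0 eqxx ME expr1 mulrC.
Qed.

Lemma tangent_space_SL n :
  tangent_space (SL R n) 1%:M = [set v : 'M[R]_n | \tr v = 0].
Proof.
apply/seteqP; split=> [v [J [A /smooth_curve_SL_near[A0 dA detA]]]|v] /=.
  exact: SL_velocity_trace A0 dA detA.
exact: SL_curve_exists.
Qed.

End TangentSpace.

(** * The Gauss map and its derivative along curves *)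

Section GaussMap.
Context {R : realType} {n : nat}.
Implicit Types (A B : 'M[R]_n) (a : R).

Lemma enorm_tr A : enorm A^T = enorm A.
Proof.
rewrite /enorm exchange_big; congr Num.sqrt.
by apply: eq_bigr => i _; apply: eq_bigr => j _; rewrite mxE.
Qed.

Lemma enormZ a A : enorm (a *: A) = `|a| * enorm A.
Proof.
rewrite -sqrtr_sqr -sqrtrM ?sqr_ge0// mulr_sumr; congr Num.sqrt.
apply: eq_bigr => i _; rewrite mulr_sumr; apply: eq_bigr => j _.
by rewrite mxE exprMn.
Qed.

Lemma enorm_gt0 A : A != 0 -> 0 < enorm A.
Proof.
move=> A0; rewrite sqrtr_gt0 lt_neqAle sumr_ge0 ?andbT; last first.
  by move=> i _; apply: sumr_ge0 => j _; exact: sqr_ge0.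
apply: contra A0; rewrite eq_sym psumr_eq0; last first.
  by move=> i _; apply: sumr_ge0 => j _; exact: sqr_ge0.
move=> /allP A0; apply/eqP/matrixP => i j; rewrite mxE.
have := A0 i (mem_index_enum i); rewrite /= psumr_eq0; last first.
  by move=> k _; exact: sqr_ge0.
by move=> /allP/(_ j (mem_index_enum j)); rewrite /= sqrf_eq0 => /eqP.
Qed.

Lemma gauss_map_det A :
  gauss_map (fun B : 'M[R]_n => \det B) A =
  (enorm (\adj A))^-1 *: (\adj A)^T.
Proof.
have gradE : gradient (fun B : 'M[R]_n => \det B) A = (\adj A)^T.
  by apply/matrixP => i j; rewrite !mxE derive_det_delta.
by rewrite /gauss_map gradE enorm_tr.
Qed.

Lemma SL_adj A : SL R n A -> \adj A = invmx A.
Proof.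
rewrite /SL/= => A1.
by rewrite /invmx unitmxE A1 unitr1 invr1 scale1r.
Qed.

(** The images have determinant a positive multiple of det (invmx B) = 1.
Conversely, for A of norm 1 and determinant c ^ n with 0 < c, the matrix
B = c *: invmx A^T has determinant 1, and its inverse c^-1 *: A^T has A as the
normalised transpose. *)
Lemma spherical_image_SL : (0 < n)%N ->
  spherical_image (fun B : 'M[R]_n => \det B) (SL R n) =
  [set A | unit_sphere A /\ 0 < \det A].
Proof.
move=> n_gt0; apply/seteqP; split=> [_ [B SB <-]|A [A1 A0]] /=.
  have d1 : \det (\adj B)^T = 1.
    by rewrite det_tr SL_adj// det_inv SB invr1.
  have g0 : 0 < enorm (\adj B).
    rewrite -enorm_tr; apply: enorm_gt0; apply/eqP => B0.
    move: d1; rewrite B0 -[X in \det X](scale0r 1%:M) detZ expr0n.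
    by rewrite -(prednK n_gt0) mul0r => /eqP; rewrite eq_sym oner_eq0.
  rewrite gauss_map_det; split.
    rewrite /unit_sphere/= enormZ enorm_tr ger0_norm ?invr_ge0 ?ltW//.
    by rewrite mulVf// gt_eqF.
  by rewrite detZ d1 mulr1 exprn_gt0// invr_gt0.
pose c := (\det A) `^ (n%:R^-1).
have c0 : 0 < c by exact: powR_gt0.
have cn : c ^+ n = \det A.
  by rewrite -powR_mulrn ?ltW// -powRrM mulVf ?powRr1 ?ltW// pnatr_eq0 -lt0n.
have uA : A^T \in unitmx by rewrite unitmx_tr unitmxE unitfE gt_eqF.
pose B := c *: invmx A^T.
have SB : SL R n B.
  by rewrite /SL/= detZ det_inv det_tr cn mulfV// gt_eqF.
exists B => //.
have iB : invmx B = c^-1 *: A^T by rewrite invmxZ ?invmxK// unitmxE SB unitr1.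
rewrite gauss_map_det SL_adj// iB enormZ enorm_tr A1 mulr1.
rewrite ger0_norm ?invr_ge0 ?ltW// invrK linearZ/= trmxK scalerA mulfV ?gt_eqF//.
by rewrite scale1r.
Qed.

Lemma det_opp A : \det (- A) = (-1) ^+ n * \det A.
Proof. by rewrite -scaleN1r detZ. Qed.

(** For n odd, opposition reverses the sign of the determinant, so that the
normal at the identity has no opposite in the image. *)
Lemma spherical_image_SL_symmetric : (0 < n)%N ->
  [set - A | A in spherical_image (fun B : 'M[R]_n => \det B) (SL R n)] =
  spherical_image (fun B : 'M[R]_n => \det B) (SL R n) <-> ~~ odd n.
Proof.
move=> n_gt0; rewrite spherical_image_SL//; split.
  move=> sym; apply/negP => oddn.
  have [A1 A0] : [set A : 'M[R]_n | unit_sphere A /\ 0 < \det A]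
      (gauss_map (fun B : 'M[R]_n => \det B) 1%:M).
    by rewrite -spherical_image_SL//; exists 1%:M => //; exact: det1.
  move: A1 A0; set A := gauss_map _ _ => A1 A0.
  have [B [_ B0] BA] : [set - A | A in [set A : 'M[R]_n |
      unit_sphere A /\ 0 < \det A]] A by rewrite sym; split.
  move: A0; rewrite -BA det_opp -signr_odd oddn expr1 mulN1r oppr_gt0.
  by move=> /(lt_trans B0); rewrite ltxx.
move=> evenn.
have det_opp' A : \det (- A) = \det A.
  by rewrite det_opp -signr_odd (negPf evenn) mul1r.
have unit_opp A : unit_sphere A -> unit_sphere (- A).
  by rewrite /unit_sphere/= -scaleN1r enormZ normrN1 mul1r.
apply/seteqP; split=> [_ [A [A1 A0] <-]|A [A1 A0]] /=.
  by split; [exact: unit_opp|rewrite det_opp'].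
exists (- A); last exact: opprK.
by split; [exact: unit_opp|rewrite det_opp'].
Qed.

(** The quotient rule: the norm of \adj (alpha t) equals sqrt n at 0 and has
derivative \tr (- v) / sqrt n = 0 there, so only the numerator, of velocity
- v^T, contributes. *)
Lemma is_derive_gauss_map (alpha : R -> 'M[R]_n) (v : 'M[R]_n) J :
  (0 < n)%N -> smooth_curve (SL R n) 1%:M v J alpha ->
  is_derive (0 : R) 1 (gauss_map (fun B : 'M[R]_n => \det B) \o alpha)
    (- ((Num.sqrt n%:R)^-1 *: v^T)).
Proof.
move=> n_gt0 /smooth_curve_SL_near[A0 dA detA].
have dB := is_derive_adj1 A0 dA detA.
have B0 : \adj (alpha 0) = 1%:M by rewrite A0 adj1.
have dg := is_derive_enorm1 n_gt0 B0 dB.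
have e1 : enorm (\adj (alpha 0)) = Num.sqrt n%:R.
  by rewrite B0 /enorm sum_sqr_scalar1.
have tr0 : \tr (- v) = 0.
  by rewrite raddfN/= (SL_velocity_trace A0 dA detA) oppr0.
rewrite tr0 mul0r in dg.
have en0 : enorm (\adj (alpha 0)) != 0.
  by rewrite e1 sqrtr_eq0 -ltNge ltr0n.
have dV := is_deriveV (f := fun t => enorm (\adj (alpha t))) en0 dg.
apply/is_derive_mxP => i j.
rewrite [X in is_derive _ _ X _](_ : _ = fun t : R =>
    (enorm (\adj (alpha t)))^-1 * \adj (alpha t) j i); last first.
  by apply/funext => t; rewrite /= gauss_map_det !mxE.
have dBji := (is_derive_mxP _ _ _ _).1 dB j i.
apply: is_derive_eq (is_deriveM dV dBji) _.
by rewrite /GRing.scale/= e1 !mulr0 addr0 !mxE mulrN.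
Qed.

End GaussMap.

(** * Eigenspaces of transposition *)

Section TransposeEigenspaces.
Context {R : realType} {n : nat}.
Implicit Types (A B H : 'M[R]_n).
Local Notation leigenspace := passmx.leigenspace.

Definition transposition : 'End('M[R]_n) := linfun trmx.
Definition traceless : {vspace 'M[R]_n} := lker (linfun (mxtrace : 'M[R]_n -> R^o)).

Lemma memv_leigenspace (vT : vectType R) (phi : 'End(vT)) (a : R) (u : vT) :
  (u \in leigenspace phi a) = (phi u == a *: u).
Proof.
by rewrite memv_ker add_lfunE opp_lfunE scale_lfunE id_lfunE subr_eq0.
Qed.

Lemma memv_traceless H : (H \in traceless) = (\tr H == 0).
Proof. by rewrite memv_ker lfunE. Qed.

(** Restricted to antisymmetric matrices this map is injective, restricted to
symmetric ones its kernel is the diagonal matrices, and the two restrictions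
have the same range; this compares the two dimensions without an explicit
basis. *)
Definition strict_upper A : 'M[R]_n :=
  \matrix_(i, j) (if (i < j)%N then A i j else 0).

Fact strict_upper_linear : linear strict_upper.
Proof.
move=> a A B; apply/matrixP => i j; rewrite !mxE.
by case: ifP => // _; rewrite mulr0 addr0.
Qed.
HB.instance Definition _ :=
  GRing.isLinear.Build R 'M[R]_n 'M[R]_n _ strict_upper strict_upper_linear.

Let u : 'End('M[R]_n) := linfun strict_upper.
Let sym := leigenspace transposition 1.
Let anti := leigenspace transposition (- 1).

Lemma memv_symmetric A : (A \in sym) = (A^T == A).
Proof. by rewrite memv_leigenspace lfunE scale1r. Qed.

Lemma memv_antisymmetric A : (A \in anti) = (A^T == - A).
Proof. by rewrite memv_leigenspace lfunE scaleN1r. Qed.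

(** Rank-nullity for A |-> A^T - A: its kernel is the symmetric matrices and
its range the antisymmetric ones, an antisymmetric A being the image of
- A / 2. *)
Lemma dim_symmetric_antisymmetric : (\dim sym + \dim anti = n * n)%N.
Proof.
have -> : (n * n = \dim {: 'M[R]_n})%N by rewrite dimvf /dim/=.
rewrite -(limg_ker_dim (transposition - 1 *: \1%VF) fullv) capfv.
congr (_ + \dim _)%N; apply/vspaceP => A; rewrite memv_antisymmetric.
apply/eqP/memv_imgP => [A1|[B _ ->]].
  exists (- (2^-1 *: A)); first exact: memvf.
  rewrite add_lfunE opp_lfunE scale_lfunE id_lfunE lfunE/= scale1r opprK.
  rewrite raddfN/= linearZ/= A1 scalerN opprK -scalerDl.
  by rewrite -[2^-1]mul1r -splitr scale1r.
rewrite add_lfunE opp_lfunE scale_lfunE id_lfunE lfunE/= scale1r.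
by rewrite linearB/= trmxK opprB.
Qed.

Lemma upper_symmetric : (u @: sym = limg u)%VS.
Proof.
apply/eqP; rewrite eqEsubv limgS ?subvf//=; apply/subvP => _ /memv_imgP[A _ ->].
apply/memv_imgP; exists (strict_upper A + (strict_upper A)^T).
  by rewrite memv_symmetric linearD/= trmxK addrC.
apply/matrixP => i j; rewrite !lfunE/= !mxE.
case: ifP => // ij; rewrite ifN ?addr0//.
by rewrite -leqNgt ltnW.
Qed.

Lemma upper_antisymmetric : (u @: anti = limg u)%VS.
Proof.
apply/eqP; rewrite eqEsubv limgS ?subvf//=; apply/subvP => _ /memv_imgP[A _ ->].
apply/memv_imgP; exists (strict_upper A - (strict_upper A)^T).
  by rewrite memv_antisymmetric linearB/= trmxK opprB.
apply/matrixP => i j; rewrite !lfunE/= !mxE.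
case: ifP => // ij; rewrite ifN ?subr0//.
by rewrite -leqNgt ltnW.
Qed.

Lemma upper_antisymmetric_inj : (anti :&: lker u = 0)%VS.
Proof.
apply/eqP; rewrite -subv0; apply/subvP => A.
rewrite memv_cap memv_antisymmetric memv_ker memv0 lfunE/=.
move=> /andP[/eqP/matrixP Aanti /eqP/matrixP Au]; apply/eqP/matrixP => i j.
have At k l : A l k = - A k l by have := Aanti k l; rewrite !mxE.
have up (k l : 'I_n) : (k < l)%N -> A k l = 0.
  by move=> kl; have := Au k l; rewrite !mxE kl.
rewrite mxE; case: (ltngtP i j) => [/up//|ji|ij].
  by rewrite At up ?oppr0.
have -> : i = j by exact: val_inj.
by apply/eqP; rewrite -eqNr -At.
Qed.

Lemma dim_diagonal : \dim (sym :&: lker u) = n.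
Proof.
pose diag : 'Hom('rV[R]_n, 'M[R]_n) := linfun (@diag_mx R n).
have diag0 : (fullv :&: lker diag = 0)%VS.
  apply/eqP; rewrite -subv0; apply/subvP => d.
  rewrite memv_cap memvf memv_ker lfunE memv0 /= => /eqP/matrixP d0.
  apply/eqP/matrixP => i j; have := d0 j j.
  by rewrite !mxE eqxx mulr1n (ord1 i).
transitivity (\dim {: 'rV[R]_n}); last by rewrite dimvf /dim/= mul1n.
rewrite -(limg_dim_eq diag0); congr (\dim _); apply/vspaceP => A.
rewrite memv_cap memv_symmetric memv_ker lfunE/=.
apply/andP/memv_imgP => [[/eqP/matrixP As /eqP/matrixP Au]|[d _ ->]].
  exists (\row_i A i i); first exact: memvf.
  have At k l : A l k = A k l by have := As k l; rewrite !mxE.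
  have up (k l : 'I_n) : (k < l)%N -> A k l = 0.
    by move=> kl; have := Au k l; rewrite !mxE kl.
  apply/matrixP => i j; rewrite lfunE/= !mxE.
  have [<-|ij] := eqVneq i j; first by rewrite mulr1n.
  rewrite mulr0n; case: (ltngtP i j) => [/up//|ji|/val_inj ij'].
    by rewrite At up.
  by rewrite ij' eqxx in ij.
rewrite lfunE/= tr_diag_mx; split=> //; apply/eqP/matrixP => i j.
rewrite !mxE; case: ifP => // ij.
by rewrite (_ : (i == j) = false)//; apply/eqP => ij'; rewrite ij' ltnn in ij.
Qed.

(** Rank-nullity for [strict_upper] on the symmetric and on the antisymmetric
matrices. *)
Lemma dim_symmetric : (\dim sym = n + \dim anti)%N.
Proof.
rewrite -(limg_ker_dim u sym) dim_diagonal upper_symmetric.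
by rewrite -upper_antisymmetric (limg_dim_eq upper_antisymmetric_inj).
Qed.

(** The trace maps the symmetric matrices onto the line, since the identity is
symmetric and has trace n, nonzero. *)
Lemma dim_traceless_symmetric : (0 < n)%N ->
  (\dim (traceless :&: sym)).+1 = \dim sym.
Proof.
move=> n_gt0; rewrite -(limg_ker_dim (linfun (mxtrace : 'M[R]_n -> R^o)) sym).
rewrite capvC -addn1; congr (_ + _)%N; apply/esym/eqP.
rewrite eqn_leq; apply/andP; split.
  by rewrite -[X in (_ <= X)%N](_ : \dim {:R^o} = 1%N) ?dimvS ?subvf// dimvf.
rewrite lt0n dimv_eq0; apply/eqP => im0.
have : linfun (mxtrace : 'M[R]_n -> R^o) 1%:M \in
    (linfun (mxtrace : 'M[R]_n -> R^o) @: sym)%VS.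
  by apply: memv_img; rewrite memv_symmetric trmx1.
by rewrite im0 memv0 lfunE/= mxtrace1 pnatr_eq0 -[n == 0%N]negbK -lt0n n_gt0.
Qed.

Lemma antisymmetric_traceless : (anti <= traceless)%VS.
Proof.
apply/subvP => A; rewrite memv_antisymmetric memv_traceless => /eqP AT.
have := mxtrace_tr A; rewrite AT raddfN/= => /eqP.
by rewrite eqNr.
Qed.

End TransposeEigenspaces.

(** * The Weingarten map and the principal curvatures *)

Section ScaledTransposition.
Context {R : realType} {n : nat}.
Variables (U : {vspace 'M[R]_n}) (L : 'End(subvs_of U)) (c : R).
Hypotheses (c_neq0 : c != 0)
  (LE : forall H : subvs_of U, vsval (L H) = c *: (vsval H)^T).
Local Notation leigenspace := passmx.leigenspace.

(** The inclusion of U in the matrices identifies the two spaces; this transfers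
the computation from endomorphisms of the subtype U to the fixed
[transposition]. *)
Lemma dim_leigenspace_scaled (e : R) :
  \dim (leigenspace L (c * e)) = \dim (U :&: leigenspace transposition e).
Proof.
pose incl : 'Hom(subvs_of U, 'M[R]_n) := linfun vsval.
have incl0 : (leigenspace L (c * e) :&: lker incl = 0)%VS.
  apply/eqP; rewrite -subv0; apply/subvP => H.
  rewrite memv_cap memv_ker memv0 lfunE/= => /andP[_ /eqP H0].
  by apply/eqP/val_inj; rewrite /= H0.
have eigE (H : subvs_of U) : (H \in leigenspace L (c * e)) =
    (vsval H \in leigenspace transposition e).
  rewrite !memv_leigenspace lfunE/= -(inj_eq val_inj)/= LE.
  by rewrite -scalerA (inj_eq (scalerI c_neq0)).
rewrite -(limg_dim_eq incl0); congr (\dim _); apply/vspaceP => A.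
rewrite memv_cap; apply/memv_imgP/andP => [[H HL ->]|[AU At]].
  by rewrite lfunE/= subvsP -eigE.
exists (vsproj U A); last by rewrite lfunE/= vsprojK.
by rewrite eigE vsprojK.
Qed.

(** Transposing c A^T = k A and substituting gives c ^ 2 A = k ^ 2 A. *)
Lemma leigenvalue_scaled (k : R) :
  passmx.leigenvalue L k -> k = c \/ k = - c.
Proof.
rewrite /passmx.leigenvalue -subv0 => /subvPn[H].
rewrite memv_leigenspace memv0 => /eqP Hk H0.
have Ht : c *: (vsval H)^T = k *: vsval H by rewrite -LE Hk.
have {H0} : vsval H != 0.
  by apply: contra H0 => /eqP vH; apply/eqP/val_inj; rewrite /= vH.
move: (vsval H : 'M[R]_n) Ht => A At A0.
have At' : c *: A = k *: A^T.
  by have := congr1 trmx At; rewrite !linearZ/= trmxK.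
have : (c ^+ 2 - k ^+ 2) *: A = 0.
  by rewrite scalerBl !expr2 -!scalerA At' -At scalerA mulrC -scalerA subrr.
move/eqP; rewrite scaler_eq0 (negPf A0) orbF subr_eq0 eq_sym eqf_sqr.
by case/orP => /eqP; [left|right].
Qed.

End ScaledTransposition.

Section Weingarten.
Context {R : realType} {n : nat}.
Local Notation leigenspace := passmx.leigenspace.
Local Notation c := ((Num.sqrt n%:R : R)^-1).
Local Notation N := (gauss_map (fun A : 'M[R]_n => \det A)).

Lemma mem_tangent_traceless (U : {vspace 'M[R]_n}) :
  [set v | v \in U] = tangent_space (SL R n) 1%:M <-> U = traceless.
Proof.
rewrite tangent_space_SL; split=> [UE|->].
  apply/vspaceP => v; rewrite memv_traceless; apply/idP/eqP.
    by move=> vU; have : [set v | v \in U] v by []; rewrite UE.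
  by move=> trv; have : [set v : 'M[R]_n | \tr v = 0] v by []; rewrite -UE.
by apply/seteqP; split=> v /=; rewrite memv_traceless => /eqP.
Qed.

Lemma weingarten_SL_exists : (0 < n)%N ->
  exists (U : {vspace 'M[R]_n}) (L : 'End(subvs_of U)),
    is_weingarten_map (SL R n) N 1%:M L.
Proof.
move=> n_gt0; exists traceless.
exists (linfun (vsproj traceless) \o (c *: transposition) \o linfun vsval)%VF.
split; first exact/mem_tangent_traceless.
move=> v J alpha curve; apply: is_derive_eq (is_derive_gauss_map n_gt0 curve) _.
rewrite !comp_lfunE lfunE/= scale_lfunE !lfunE/= vsprojK//.
have /eqP trv : \tr (vsval v) == 0 by rewrite -memv_traceless subvsP.
by rewrite memv_traceless mxtraceZ mxtrace_tr trv mulr0.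
Qed.

(** The value of L at H is tested on a curve of velocity H, which exists because
U is the tangent space; derivatives are unique. *)
Lemma weingarten_SLE (U : {vspace 'M[R]_n}) (L : 'End(subvs_of U)) :
  (0 < n)%N -> is_weingarten_map (SL R n) N 1%:M L ->
  forall H : subvs_of U, vsval (L H) = c *: (vsval H)^T.
Proof.
move=> n_gt0 [UE LN] H.
have [J [alpha curve]] : tangent_space (SL R n) 1%:M (vsval H).
  by rewrite -UE /= subvsP.
have d1 := LN _ _ _ curve; have d2 := is_derive_gauss_map n_gt0 curve.
apply: oppr_inj; rewrite -(@derive_val _ _ _ _ _ _ _ d1).
exact: (@derive_val _ _ _ _ _ _ _ d2).
Qed.

Lemma dims_curvature_spaces : (0 < n)%N ->
  \dim (traceless :&: leigenspace (@transposition R n) 1) =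
    ((n ^ 2 + n - 2) %/ 2)%N /\
  \dim (traceless :&: leigenspace (@transposition R n) (- 1)) =
    ((n ^ 2 - n) %/ 2)%N.
Proof.
move=> n_gt0; rewrite (capv_idPr antisymmetric_traceless).
have arith s a t : (s + a = n * n -> s = n + a -> t.+1 = s ->
    t = (n ^ 2 + n - 2) %/ 2 /\ a = (n ^ 2 - n) %/ 2)%N.
  by rewrite -mulnn; move: (n * n)%N => m; lia.
exact: arith dim_symmetric_antisymmetric dim_symmetric
  (dim_traceless_symmetric n_gt0).
Qed.

End Weingarten.

Theorem mainTheorem1 (R : realType) (n : nat) (n_gt0 : (0 < n)%N) :
  let f : 'M[R]_n -> R := fun A => \det A in
  let S : set 'M[R]_n := SL R n in
  let N : 'M[R]_n -> 'M[R]_n := gauss_map f in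
  let c : R := (Num.sqrt n%:R)^-1 in
  let mp : nat := ((n ^ 2 + n - 2) %/ 2)%N in
  let mm : nat := ((n ^ 2 - n) %/ 2)%N in
  [/\ (forall A, S A -> N A = (enorm (invmx A))^-1 *: (invmx A)^T),
      spherical_image f S = [set A | unit_sphere A /\ 0 < \det A],
      ([set - A | A in spherical_image f S] = spherical_image f S <-> ~~ odd n),
      (exists (U : {vspace 'M[R]_n}) (L : 'End(subvs_of U)),
         is_weingarten_map S N 1%:M L) &
      (forall (U : {vspace 'M[R]_n}) (L : 'End(subvs_of U)),
         is_weingarten_map S N 1%:M L ->
         (forall H : subvs_of U, vsval (L H) = c *: (vsval H)^T) /\
         [/\ (forall k : R, passmx.leigenvalue L k <->
                (k = c /\ (0 < mp)%N) \/ (k = - c /\ (0 < mm)%N)),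
             \dim (passmx.leigenspace L c) = mp &
             \dim (passmx.leigenspace L (- c)) = mm])].
Proof.
move=> f S N c mp mm; split.
- by move=> A SA; rewrite /N gauss_map_det SL_adj.
- exact: spherical_image_SL.
- exact: spherical_image_SL_symmetric.
- exact: weingarten_SL_exists.
move=> U L WL; have LE := weingarten_SLE n_gt0 WL.
have c_neq0 : c != 0 by rewrite invr_eq0 sqrtr_eq0 -ltNge ltr0n.
have UE : U = traceless by apply/mem_tangent_traceless; case: WL.
have [dp dm] := @dims_curvature_spaces R n n_gt0.
have dimc : \dim (passmx.leigenspace L c) = mp.
  by rewrite -[c]mulr1 (dim_leigenspace_scaled c_neq0 LE) UE.
have dimNc : \dim (passmx.leigenspace L (- c)) = mm.
  by rewrite -[c in - c]mulr1 -mulrN (dim_leigenspace_scaled c_neq0 LE) UE.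
have eigE l : passmx.leigenvalue L l = (0 < \dim (passmx.leigenspace L l))%N.
  by rewrite lt0n dimv_eq0.
split=> //; split=> // k; split=> [Lk|].
  have [kE|kE] := leigenvalue_scaled LE Lk; [left|right]; split=> //;
    by move: Lk; rewrite kE eigE ?dimc ?dimNc.
by case=> [[->]|[->]]; rewrite eigE ?dimc ?dimNc.
Qed.
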